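(* Let $s,t\geq 1$ be integers and let $p,q,l$ be three distinct primes with $p,q$ odd, $p\equiv 3 \pmod 4$, $\mathrm{ord}_{p^s}(l)=\phi(p^s)/2$, $\mathrm{ord}_{q^t}(l)=\phi(q^t)$ and $\gcd(\phi(p^s),\phi(q^t))=2$. Let $0\leq i<i'\leq s-1$ and $0\leq j\leq t-1$. Then in the ring $\mathbb{F}_l[x]/\langle x^{p^sq^t}-1\rangle$: (i) If $q$ is a quadratic residue modulo $p$, then \[\chi_{ij}^*\chi_{i'j}=\frac{\phi(p^{s-i'})}{2}(q-2)q^{t-j-1}\chi_{ij}^*+\frac{\phi(p^{s-i'})}{2}\phi(q^{t-j})\sum_{j<m\leq t}\chi_{im}^*.\] (ii) If $q$ is a quadratic nonresidue modulo $p$, then \[ \chi_{ij}^*\chi_{i'j}=\frac{\phi(p^{s-i'})}{2}(q-2)q^{t-j-1}\chi_{ij}^*+\frac{\phi(p^{s-i'})}{2}\phi(q^{t-j})\Big(\sum_{\substack{j<m\leq t\\2\nmid m-j}}\chi_{im}+\sum_{\substack{j<m\leq t\\2\mid m-j}}\chi_{im}^*\Big). \]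
   Context: Here $\phi$ is Euler's phi function (with $\phi(1)=1$) and $\mathrm{ord}_m(k)$ is the multiplicative order of $k$ modulo $m$. Put $n=p^sq^t$. Fix an integer $g$ that is a primitive root both modulo $p^s$ and modulo $q^t$. For an integer $\gamma$, $C_\gamma=\{\gamma l^r \bmod n: r\geq 0\}\subseteq \mathbb{Z}_n$ is the $l$-cyclotomic coset modulo $n$ containing $\gamma$. For $0\leq i\leq s$, $0\leq j\leq t$ set $C_{ij}=C_{p^iq^j}$ and $C_{ij}^*=C_{p^iq^jg}$. Define elements of $\mathbb{F}_l[x]/\langle x^{n}-1\rangle$ by $\chi_{ij}=\sum_{\alpha\in C_{ij}}x^\alpha$ and $\chi_{ij}^*=\sum_{\alpha\in C_{ij}^*}x^\alpha$. Integer coefficients are read in $\mathbb{F}_l$, and empty sums are $0$. *)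

(* Defs.v *)
From mathcomp Require Import all_boot all_order all_algebra.
From mathcomp Require Import boolp.

Set Implicit Arguments.
Unset Strict Implicit.
Unset Printing Implicit Defensive.

Import GRing.Theory.
Local Open Scope ring_scope.

(* ord_m(k) = d. As a relation, it needs no default value when k is not a unit
   modulo m: no d is then related to m and k. *)
Definition is_mult_order (m : nat) (k : int) (d : nat) : Prop :=
  [/\ (0 < d)%N,
      (k ^+ d = 1 %[mod m%:Z])%Z
    & forall e : nat, (0 < e)%N -> (k ^+ e = 1 %[mod m%:Z])%Z -> (d <= e)%N].

Definition is_primitive_root (m : nat) (g : int) : Prop :=
  is_mult_order m g (totient m).

Definition quad_residue (p a : nat) : Prop :=
  coprime a p /\ exists x : nat, (x ^ 2 = a %[mod p])%N.

Definition quad_nonresidue (p a : nat) : Prop :=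
  coprime a p /\ ~ exists x : nat, (x ^ 2 = a %[mod p])%N.

(* Residues modulo n are represented by 'I_n. *)
Definition cyclotomic_coset (n l : nat) (gamma : int) : {set 'I_n} :=
  [set a : 'I_n | `[< exists r : nat, a%:Z = (gamma * l%:Z ^+ r %% n%:Z)%Z >]].

(* For n > 0, this is F_l[x] / <x ^ n - 1>, by cyclic_modulusE. *)
Notation cyclic_ring l n := {poly %/ ('X^n - 1 : {poly 'F_l})}.

Lemma cyclic_modulusE (l n : nat) : (0 < n)%N ->
  mk_monic ('X^n - 1 : {poly 'F_l}) = 'X^n - 1.
Proof.
by move=> n_gt0; rewrite /mk_monic size_XnsubC // ltnS n_gt0 monicXnsubC.
Qed.

Definition coset_sum (n l : nat) (gamma : int) : cyclic_ring l n :=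
  \sum_(a in cyclotomic_coset n l gamma) 'qX ^+ (a : nat).

Definition chi (p q s t l i j : nat) : cyclic_ring l (p ^ s * q ^ t)%N :=
  coset_sum (p ^ s * q ^ t) l (p ^ i * q ^ j)%N%:Z.

Definition chi_star (p q s t l : nat) (g : int) (i j : nat) :
    cyclic_ring l (p ^ s * q ^ t)%N :=
  coset_sum (p ^ s * q ^ t) l ((p ^ i * q ^ j)%N%:Z * g).

(* Main.v *)
(* By the Chinese remainder theorem x^a = y^a z^a with y^(p^s) = z^(q^t) = 1.
   Since p = 3 mod 4, the orders phi(p^s)/2 and phi(q^t) of l are coprime, so
   every coset sum factors as (coset sum in y) * (coset sum in z).
   - Modulo p^s, l generates the squares, so the cosets of p^i a and p^i b agree
     as soon as a and b have the same quadratic character modulo p. Hence the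
     coset of p^i a is stable under translation by multiples of p^(i+1), and
     multiplying its sum by that of p^i' b, i < i', only multiplies it by the
     size phi(p^(s-i'))/2 of the second coset.
   - Modulo q^t, l generates all units, so the coset of q^j is T_j minus T_(j+1)
     where T_j is the set of multiples of q^j; the sums over these subgroups
     satisfy T_j T_k = q^(t-k) T_j for j <= k, which gives the square of the
     sum of the coset of q^j.
   Comparing quadratic characters turns the remaining terms into chi or chi*. *)
Require Import Defs.
From mathcomp Require Import all_boot all_order all_algebra.
From mathcomp Require Import fingroup cyclic boolp zify ring.

Set Implicit Arguments.
Unset Strict Implicit.
Unset Printing Implicit Defensive.

Import GRing.Theory.
Local Open Scope ring_scope.

(** * Congruences and multiplicative orders *)

Lemma eqz_mod_nat (a b m : nat) :
  (a%:Z = b %[mod m%:Z])%Z <-> (a = b %[mod m])%N.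
Proof. by rewrite !modz_nat; split=> [[]|->]. Qed.

Lemma eqz_mod_dvdm (m n a b : int) : (m %| n)%Z ->
  (a = b %[mod n])%Z -> (a = b %[mod m])%Z.
Proof.
move=> mn /eqP; rewrite eqz_mod_dvd => nab; apply/eqP; rewrite eqz_mod_dvd.
exact: dvdz_trans nab.
Qed.

Lemma dvdn_modr (d m n : nat) : (d %| m)%N -> (d %| n %% m)%N = (d %| n)%N.
Proof. by move=> dm; rewrite /dvdn modn_dvdm. Qed.

Lemma eq_mult_order_mod (m : nat) (k k' : int) (d : nat) :
  (k = k' %[mod m%:Z])%Z -> is_mult_order m k d -> is_mult_order m k' d.
Proof.
move=> kk'; have kX e : (k ^+ e = k' ^+ e %[mod m%:Z])%Z.
  by rewrite -modzXm kk' modzXm.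
by case=> d_gt0 kd d_min; split=> // [|e e_gt0]; rewrite -kX //; apply: d_min.
Qed.

(** Trades minimality for divisibility: the remainder of [e] by [d] is again an exponent killing
    [k], so minimality of [d] makes it zero. *)
Lemma is_mult_orderP (m k d : nat) :
  is_mult_order m k%:Z d <->
  (0 < d)%N /\ forall e, (k ^ e == 1 %[mod m])%N = (d %| e)%N.
Proof.
have kXE e : (k%:Z ^+ e = 1 %[mod m%:Z])%Z <-> (k ^ e = 1 %[mod m])%N.
  by rewrite -natz -natrX natz; exact: eqz_mod_nat.
split=> [[d_gt0 /kXE kd1 d_min] | [d_gt0 kE]].
  split=> // e; have kXd u : (k ^ (u * d) = 1 %[mod m])%N.
    by rewrite mulnC expnM -modnXm kd1 modnXm exp1n.
  apply/eqP/idP => [ke1 | /dvdnP[u ->] //].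
  have: (k ^ (e %% d) = 1 %[mod m])%N.
    rewrite -ke1 [in RHS](divn_eq e d) expnD -[in RHS]modnMml.
    by rewrite kXd modnMml mul1n.
  rewrite /dvdn; case: posnP => // ed_gt0 /kXE /(d_min _ ed_gt0).
  by rewrite leqNgt ltn_pmod.
split=> // [|e e_gt0 /kXE/eqP]; first by apply/kXE/eqP; rewrite kE.
by rewrite kE => /dvdn_leq ->.
Qed.

Lemma mult_order_coprime (m k d : nat) : is_mult_order m k%:Z d -> coprime k m.
Proof.
case/is_mult_orderP=> d_gt0 kE.
have /eqP kd : (k ^ d == 1 %[mod m])%N by rewrite kE.
rewrite -(coprime_pexpl _ _ d_gt0) -coprime_modl kd coprime_modl.
exact: coprime1n.
Qed.

Lemma mult_order_expn_eq (m k d a b : nat) :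
  is_mult_order m k%:Z d ->
  (k ^ a == k ^ b %[mod m])%N = (a == b %[mod d])%N.
Proof.
move=> ok; have km := mult_order_coprime ok.
have [_ kE] := (is_mult_orderP _ _ _).1 ok.
(* Zero is a unit only modulo 1, where [d = 1]. For positive [k] one power is subtracted from the
   other and the smaller one is cancelled as a unit. *)
have [k0|k_gt0] := posnP k.
  move: km (kE 1%N); rewrite k0 /coprime gcd0n => /eqP ->.
  by rewrite !modn1 eqxx dvdn1 => /esym/eqP->; rewrite !modn1.
wlog le_ba : a b / (b <= a)%N.
  by case/orP: (leq_total b a) => le IH; [|rewrite eq_sym [RHS]eq_sym]; apply: IH.
rewrite !eqn_mod_dvd ?leq_pexp2l // -kE eqn_mod_dvd ?expn_gt0 ?k_gt0 //.
rewrite -{1}(subnK le_ba) expnD -{2}[(k ^ b)%N]mul1n -mulnBl.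
by rewrite Gauss_dvdl // coprime_sym coprimeXl.
Qed.

Lemma eqn_modMl (x a b m : nat) : (0 < x)%N ->
  (x * a == x * b %[mod x * m])%N = (a == b %[mod m])%N.
Proof. by move=> x_gt0; rewrite -!muln_modr eqn_pmul2l. Qed.

(** * Cyclic unit groups and lifting of congruences *)

(** The primitive root [g] makes the unit group cyclic. Inclusion of subgroups of a cyclic group
    amounts to divisibility of their orders, so [c] lies in the subgroup generated by [l]. *)
Lemma cyclic_power (m g l d c : nat) : (1 < m)%N ->
  is_primitive_root m g%:Z -> is_mult_order m l%:Z d ->
  (c ^ d = 1 %[mod m])%N -> exists r, (c = l ^ r %[mod m])%N.
Proof.
move=> m_gt1 og ol cd1.
have [d_gt0 _] := (is_mult_orderP _ _ _).1 ol.
have cm : coprime c m.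
  by rewrite -(coprime_pexpl _ _ d_gt0) -coprime_modl cd1 coprime_modl coprime1n.
have natU x : coprime x m -> (x%:R : 'Z_m) \is a GRing.unit.
  by rewrite unitZpE // coprime_sym.
pose U x (xm : coprime x m) : {unit 'Z_m} := FinRing.unit _ (natU x xm).
have UXE x y (xm : coprime x m) (ym : coprime y m) a b :
    ((U x xm ^+ a)%g == (U y ym ^+ b)%g) = (x ^ a == y ^ b %[mod m])%N.
  rewrite -val_eqE !FinRing.val_unitX /=. rewrite -!natrX. rewrite -val_eqE /=.
  by rewrite !val_Zp_nat.
have U1E x xm a : ((U x xm ^+ a)%g == 1%g) = (x ^ a == 1 %[mod m])%N.
  by rewrite -(UXE x x xm xm a 0%N).
have ordU x xm e : is_mult_order m x%:Z e -> #[U x xm]%g = e.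
  case/is_mult_orderP=> _ xE; apply/eqP; rewrite eqn_dvd order_dvdn U1E xE dvdnn.
  by rewrite -xE -U1E expg_order eqxx.
have gm := mult_order_coprime og; have lm := mult_order_coprime ol.
have cardU : #|[set: {unit 'Z_m}]| = totient m.
  by rewrite -(card_units_Zp (ltnW m_gt1)).
have cycU : cyclic [set: {unit 'Z_m}]%G.
  apply/cyclicP; exists (U g gm); apply/eqP; rewrite eq_sym eqEcard subsetT.
  by rewrite cardU -orderE (ordU _ gm _ og) leqnn.
have : (U c cm \in <[U l lm]>)%g.
  rewrite -cycle_subG -(cardSg_cyclic cycU) ?subsetT //.
  by rewrite -!orderE (ordU _ lm _ ol) order_dvdn U1E cd1.
case/cycleP=> r /eqP; rewrite -[U c cm]expg1 UXE expn1 => /eqP.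
by exists r.
Qed.

(** Each [p]-th power gains a factor [p]: [a ^ p - 1] is [a - 1] times a sum of [p] powers of [a],
    all congruent to 1 modulo [p]. *)
Lemma expn_prime_pow_lift (p a k m : nat) : prime p ->
  (a = 1 %[mod p ^ k.+1])%N -> (a ^ (p ^ m) = 1 %[mod p ^ (k + m).+1])%N.
Proof.
move=> pp; elim: m a k => [|m IH] a k a1; first by rewrite expn1 addn0.
rewrite expnS expnM addnS -addSn; apply: IH.
have p_gt1 := prime_gt1 pp.
have pk_gt1 u : (1 < p ^ u.+1)%N.
  by rewrite -(expn0 p) ltn_exp2l.
have a_gt0 : (0 < a)%N.
  by case: a a1 => // /eqP; rewrite mod0n modn_small.
apply/eqP; rewrite eqn_mod_dvd ?expn_gt0 ?a_gt0 // -(exp1n p) subn_exp.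
rewrite [X in (X %| _)%N]expnSr dvdn_mul //.
  by rewrite -eqn_mod_dvd //; apply/eqP.
have a1p : (a = 1 %[mod p])%N.
  have pd : (p %| p ^ k.+1)%N by rewrite expnS dvdn_mulr.
  by rewrite -(modn_dvdm a pd) a1 modn_dvdm.
rewrite /dvdn -modn_summ.
under eq_bigr => i _ do rewrite exp1n muln1 -modnXm a1p modnXm exp1n.
by rewrite modn_summ sum_nat_const card_ord muln1 modnn.
Qed.

Lemma eqr_Fp_nat (p a b : nat) : prime p ->
  ((a%:R : 'F_p) == b%:R) = (a == b %[mod p])%N.
Proof.
by move=> pp; rewrite -val_eqE /= !val_Fp_nat.
Qed.

(** * Cyclotomic cosets and sums over sets of residues *)

Lemma mem_cyclotomic_coset (n l c : nat) (a : 'I_n) :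
  reflect (exists r, (a = c * l ^ r %[mod n])%N)
          (a \in cyclotomic_coset n l c%:Z).
Proof.
have E r : (a%:Z = (c%:Z * l%:Z ^+ r %% n%:Z)%Z) <-> (a = c * l ^ r %[mod n])%N.
  rewrite -[l%:Z]natz -natrX natz -PoszM modz_nat (modn_small (ltn_ord a)).
  by split=> [[]|->].
by rewrite inE; apply: (iffP (asboolP _)) => -[r /E]; exists r.
Qed.

Lemma eq_cyclotomic_coset_mod (n l : nat) (x y : int) : (x = y %[mod n%:Z])%Z ->
  cyclotomic_coset n l x = cyclotomic_coset n l y.
Proof.
move=> xy; apply/setP=> a; rewrite !inE; apply/asboolP/asboolP => -[r ->];
  by exists r; rewrite -modzMml (xy, esym xy) modzMml.
Qed.

Lemma cyclotomic_coset_mulX (n l d c r : nat) : is_mult_order n l%:Z d ->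
  cyclotomic_coset n l (c * l ^ r)%N%:Z = cyclotomic_coset n l c%:Z.
Proof.
move=> ol; have [d_gt0 _ _] := ol; apply/setP=> a.
apply/mem_cyclotomic_coset/mem_cyclotomic_coset => -[u ->].
  by exists (r + u)%N; rewrite expnD mulnA.
(* Since [l ^ d = 1], the power [l ^ (r * d.-1)] inverts [l ^ r]. *)
exists (u + r * d.-1)%N.
rewrite -mulnA -expnD addnCA -mulnS prednK // -[RHS]modnMmr.
have /eqP <- : (l ^ u == l ^ (u + r * d) %[mod n])%N.
  by rewrite (mult_order_expn_eq _ _ ol) addnC modnMDl.
by rewrite modnMmr.
Qed.

Lemma eq_cyclotomic_coset (n l d b c r : nat) : is_mult_order n l%:Z d ->
  (b = c * l ^ r %[mod n])%N ->
  cyclotomic_coset n l b%:Z = cyclotomic_coset n l c%:Z.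
Proof.
move=> ol bE; rewrite -(cyclotomic_coset_mulX c r ol).
by apply: eq_cyclotomic_coset_mod; apply/eqz_mod_nat.
Qed.

(** Counts a set of residues enumerated by a map of exact period [d]. It serves for cosets, with
    [f r = c * l ^ r], and for the multiples of [q ^ k]. *)
Lemma card_image_ord (n d : nat) (A : {set 'I_n}) (f : nat -> nat) :
  (0 < n)%N ->
  (forall a : 'I_n, reflect (exists r, (a = f r %[mod n])%N) (a \in A)) ->
  (forall u v, (f u == f v %[mod n])%N = (u == v %[mod d])%N) ->
  (0 < d)%N -> #|A| = d.
Proof.
case: n A => // n A _ AP fE d_gt0.
have -> : A = [set inord (f u %% n.+1) | u : 'I_d].
  apply/setP=> a; apply/AP/imsetP => [[r aE] | [u _ ->]].
    exists (Ordinal (ltn_pmod r d_gt0)) => //=; apply: val_inj.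
    have /eqP <- : (f r == f (r %% d) %[mod n.+1])%N by rewrite fE modn_mod.
    by rewrite [RHS]inordK ?ltn_pmod // -aE modn_small.
  by exists u; rewrite inordK ?ltn_pmod // modn_mod.
rewrite card_imset ?card_ord // => u v /(congr1 val).
rewrite /= !inordK ?ltn_pmod // => /eqP; rewrite fE !modn_small // => /eqP.
exact: val_inj.
Qed.

(* Each b in B permutes A, so multiplication by y^b fixes the sum over A. *)
Lemma sum_expr_shift (R : comNzRingType) (n : nat) (y : R) (A B : {set 'I_n}) :
  y ^+ n = 1 ->
  (forall a b : 'I_n, a \in A -> b \in B ->
     exists2 c : 'I_n, c \in A & (c = a + b %[mod n])%N) ->
  (\sum_(a in A) y ^+ a) * (\sum_(b in B) y ^+ b)
    = (\sum_(a in A) y ^+ a) *+ #|B|.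
Proof.
case: n A B => [|n] A B yn shiftA.
  by rewrite [\sum_(a in A) _]big1 ?mul0r ?mul0rn // => -[].
rewrite mulr_sumr -sumr_const; apply: eq_bigr => b bB.
pose h (a : 'I_n.+1) : 'I_n.+1 := inord ((a + b) %% n.+1)%N.
have hE a : h a = ((a + b) %% n.+1)%N :> nat by rewrite inordK ?ltn_pmod.
have hI : injective h.
  move=> a c /(congr1 val); rewrite /= !hE => /eqP; rewrite eqn_modDr.
  by rewrite !modn_small // => /eqP/val_inj.
have hA : h @: A = A.
  apply/eqP; rewrite eqEcard card_imset // leqnn andbT.
  apply/subsetP=> _ /imsetP[a aA ->]; have [c cA cE] := shiftA a b aA bB.
  suff -> : h a = c by [].
  by apply: val_inj; rewrite /= hE -cE modn_small.
rewrite -{2}hA big_imset; last by move=> ? ? _ _; apply: hI.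
rewrite mulr_suml; apply: eq_bigr => a _.
by rewrite -exprD hE -(expr_mod _ yn).
Qed.

(** A coset sum evaluated at any ring element, so that it also applies to the two Chinese remainder
    components of ['qX]. *)
Definition pow_sum (R : comNzRingType) (y : R) (n l : nat) (c : int) : R :=
  \sum_(a in cyclotomic_coset n l c) y ^+ (a : nat).

(** * Coset sums modulo [p ^ s], where [l] generates the squares *)

(* h is (p - 1) / 2, so that a |-> a^h is the quadratic character mod p. *)
Section PrimePower.

Variables (p h s l g : nat).
Hypotheses (pp : prime p) (ph : p.-1 = h.*2) (s_gt0 : (0 < s)%N).
Hypothesis lP : is_mult_order (p ^ s) l%:Z (totient (p ^ s) %/ 2).
Hypothesis gP : is_primitive_root (p ^ s) g%:Z.

Lemma totient_prime_power_half k : (0 < k)%N ->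
  (totient (p ^ k) %/ 2 = h * p ^ k.-1)%N.
Proof. by move=> k_gt0; rewrite totient_pfactor // ph -muln2 mulnAC mulnK. Qed.

Lemma expn_half_lift c k : (0 < k)%N -> (c ^ h = 1 %[mod p])%N ->
  (c ^ (totient (p ^ k) %/ 2) = 1 %[mod p ^ k])%N.
Proof.
case: k => // k _ ch; rewrite totient_prime_power_half // expnM.
by have := @expn_prime_pow_lift p (c ^ h) 0 k pp; apply; rewrite expn1.
Qed.

(** By Fermat's little theorem. This reads the quadratic character of [l] off its order modulo
    [p ^ s]. *)
Lemma expn_half_down c k : (c ^ (h * p ^ k) = c ^ h %[mod p])%N.
Proof.
elim: k => [|k IH]; first by rewrite muln1.
by rewrite expnSr mulnA expnM fermat_little.
Qed.

Lemma half_pred_gt0 : (0 < h)%N.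
Proof. by move: (prime_gt1 pp) ph; case: (h) => //; case: (p) => // -[]. Qed.

Lemma dvdn_expn_pos : (p %| p ^ s)%N.
Proof. by rewrite -{1}(expn1 p) dvdn_exp2l. Qed.

Lemma mult_generator_expn_half : (l ^ h = 1 %[mod p])%N.
Proof.
have [_ /(_ (h * p ^ s.-1)%N)] := (is_mult_orderP _ _ _).1 lP.
rewrite totient_prime_power_half // dvdnn => /eqP lE.
rewrite -(expn_half_down _ s.-1) -(modn_dvdm _ dvdn_expn_pos) lE.
by rewrite (modn_dvdm _ dvdn_expn_pos).
Qed.

(** If [l ^ e = 1] modulo [p ^ k], raising to the power [p ^ (s - k)] gives 1 modulo [p ^ s]. So
    [h * p ^ (s - 1)] divides [e * p ^ (s - k)], and [p ^ (s - k)] cancels. *)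
Lemma mult_order_prime_power k : (0 < k <= s)%N ->
  is_mult_order (p ^ k) l%:Z (totient (p ^ k) %/ 2).
Proof.
case/andP=> k_gt0 le_ks; apply/is_mult_orderP; split.
  by rewrite totient_prime_power_half // muln_gt0 half_pred_gt0 expn_gt0 prime_gt0.
move=> e; apply/eqP/idP => [le1 | /dvdnP[u ->]]; last first.
  rewrite mulnC expnM -modnXm (expn_half_lift k_gt0 mult_generator_expn_half).
  by rewrite modnXm exp1n.
have [_ lE] := (is_mult_orderP _ _ _).1 lP.
have := @expn_prime_pow_lift p (l ^ e) k.-1 (s - k) pp.
rewrite prednK // -addSn prednK // subnKC // -expnM => /(_ le1)/eqP.
rewrite lE !totient_prime_power_half //.
have -> : s.-1 = (k.-1 + (s - k))%N by lia.
by rewrite expnD mulnA dvdn_pmul2r // expn_gt0 prime_gt0.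
Qed.

(** The quotient of [a] by [b] has [h]-th power 1 modulo [p]; by lifting and cyclicity it is a power
    of [l] modulo [p ^ s]. *)
Lemma eq_coset_expn_half x a b : coprime b p ->
  (a ^ h = b ^ h %[mod p])%N ->
  cyclotomic_coset (p ^ s) l (x * a)%N%:Z
    = cyclotomic_coset (p ^ s) l (x * b)%N%:Z.
Proof.
move=> bp abE; have bps : coprime b (p ^ s) by rewrite coprimeXr.
have phi_gt0 : (0 < totient (p ^ s))%N by rewrite totient_gt0 expn_gt0 prime_gt0.
have bphi := Euler_exp_totient bps.
(* By Euler's theorem the second factor is the inverse of [b] modulo [p ^ s]. *)
pose c := (a * b ^ (totient (p ^ s)).-1)%N.
have ch : (c ^ h = 1 %[mod p])%N.
  rewrite expnMn -modnMml abE modnMml -expnMn -expnS prednK // -modnXm.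
  rewrite -(modn_dvdm (b ^ _) dvdn_expn_pos) bphi (modn_dvdm _ dvdn_expn_pos).
  by rewrite modnXm exp1n.
have ps_gt1 : (1 < p ^ s)%N by rewrite -(expn0 p) ltn_exp2l ?prime_gt1.
have [r cE] := cyclic_power ps_gt1 gP lP (expn_half_lift s_gt0 ch).
apply: (@eq_cyclotomic_coset _ _ _ _ _ r lP).
rewrite -[RHS]modnMmr -cE modnMmr /c -mulnA [(b * _)%N]mulnCA -expnS prednK //.
by rewrite mulnA -[RHS]modnMmr bphi modnMmr muln1.
Qed.

(** After cancelling [p ^ i] and the unit [a], the period of the coset is the order of [l] modulo
    [p ^ (s - i)]. *)
Lemma card_coset_prime_power i a : coprime a p -> (i < s)%N ->
  #|cyclotomic_coset (p ^ s) l (p ^ i * a)%N%:Z| = (totient (p ^ (s - i)) %/ 2)%N.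
Proof.
move=> ap lt_is; have si_gt0 : (0 < s - i <= s)%N by rewrite subn_gt0 lt_is leq_subr.
have oi := mult_order_prime_power si_gt0.
apply: (card_image_ord (f := fun r => (p ^ i * a * l ^ r)%N)).
- by rewrite expn_gt0 prime_gt0.
- by move=> x; apply: mem_cyclotomic_coset.
- move=> u v; rewrite -(mult_order_expn_eq _ _ oi) -!mulnA.
  rewrite -{1 2}(subnKC (ltnW lt_is)) expnD eqn_modMl ?expn_gt0 ?prime_gt0 //.
  have asi : coprime a (p ^ (s - i)) by rewrite coprimeXr.
  have := Euler_exp_totient asi.
  set e := totient _ => ae1.
  have e_gt0 : (0 < e)%N by rewrite totient_gt0 expn_gt0 prime_gt0.
  apply/eqP/eqP => [E | E]; last by rewrite -modnMmr E modnMmr.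
  have K x : (x = a ^ e.-1 * (a * x) %[mod p ^ (s - i)])%N.
    by rewrite mulnA -expnSr prednK // -[RHS]modnMml ae1 modnMml mul1n.
  by rewrite K -modnMmr E modnMmr -K.
- by case: oi.
Qed.

Lemma coset_sum_shift (R : comNzRingType) (y : R) i i' a b :
  y ^+ (p ^ s) = 1 -> coprime a p -> coprime b p -> (i < i')%N -> (i' < s)%N ->
  pow_sum y (p ^ s) l (p ^ i * a)%N%:Z * pow_sum y (p ^ s) l (p ^ i' * b)%N%:Z
    = pow_sum y (p ^ s) l (p ^ i * a)%N%:Z *+ (totient (p ^ (s - i')) %/ 2)%N.
Proof.
move=> yn ap bp lt_ii' lt_i's; rewrite -(card_coset_prime_power bp lt_i's).
apply: sum_expr_shift => // u v /mem_cyclotomic_coset[r uE] /mem_cyclotomic_coset[r' vE].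
(* The translated element is [p ^ i * c]. As [i < i'], the second term is a multiple of [p], so [c]
   has the quadratic character of [a]. *)
pose c := (a * l ^ r + p * (p ^ (i' - i.+1) * b * l ^ r'))%N.
have cE : (c = a * l ^ r %[mod p])%N by rewrite /c [(p * _)%N]mulnC addnC modnMDl.
have ps_gt0 : (0 < p ^ s)%N by rewrite expn_gt0 prime_gt0.
exists (Ordinal (ltn_pmod (p ^ i * c) ps_gt0)).
  rewrite -(@eq_coset_expn_half _ c) //.
    by apply/mem_cyclotomic_coset; exists 0%N; rewrite /= modn_mod muln1.
  rewrite -modnXm cE modnXm expnMn -expnM mulnC [(r * h)%N]mulnC expnM.
  rewrite -modnMml -modnXm mult_generator_expn_half.
  by rewrite modnXm exp1n modnMml mul1n.
rewrite /= modn_mod -[RHS]modnDm uE vE modnDm /c; congr (_ %% _)%N.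
by rewrite mulnDr !mulnA -expnSr -expnD subnKC.
Qed.

End PrimePower.

(** * Coset sums modulo [q ^ t], where [l] is a primitive root *)

Section PrimitivePrimePower.

Variables (q t l : nat).
Hypotheses (pq : prime q) (t_gt0 : (0 < t)%N).
Hypothesis lP : is_primitive_root (q ^ t) l%:Z.

Lemma prime_power_gt0 k : (0 < q ^ k)%N.
Proof. by rewrite expn_gt0 prime_gt0. Qed.

Lemma coset_prime_power_unit x u : coprime u q ->
  cyclotomic_coset (q ^ t) l (x * u)%N%:Z = cyclotomic_coset (q ^ t) l x%:Z.
Proof.
move=> uq; have uqt : coprime u (q ^ t) by rewrite coprimeXr.
have qt_gt1 : (1 < q ^ t)%N by rewrite -(expn0 q) ltn_exp2l ?prime_gt1.
have [r uE] := cyclic_power qt_gt1 lP lP (Euler_exp_totient uqt).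
by apply: (@eq_cyclotomic_coset _ _ _ _ _ r lP); rewrite -modnMmr uE modnMmr.
Qed.

(** A residue of exact [q]-adic valuation [m] is [q ^ m] times a unit, and every unit is a power of
    [l]. *)
Lemma mem_coset_prime_power m (b : 'I_(q ^ t)) : (m < t)%N ->
  (b \in cyclotomic_coset (q ^ t) l (q ^ m)%N%:Z)
    = (q ^ m %| b)%N && ~~ (q ^ m.+1 %| b)%N.
Proof.
move=> lt_mt; have dvd_t k : (k <= t)%N -> (q ^ k %| q ^ t)%N by apply: dvdn_exp2l.
have lq : coprime l q.
  by apply: coprime_dvdr (mult_order_coprime lP); rewrite -{1}(expn1 q) dvd_t.
apply/mem_cyclotomic_coset/andP => [[r bE] | [/dvdnP[u bE] qNb]].
  have dvdE k : (k <= t)%N -> (q ^ k %| b)%N = (q ^ k %| q ^ m * l ^ r)%N.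
    by move=> /dvd_t dk; rewrite -[LHS](dvdn_modr _ dk) bE dvdn_modr.
  rewrite !dvdE // ?(ltnW lt_mt) // dvdn_mulr // expnSr dvdn_pmul2l ?prime_power_gt0 //.
  by split=> //; rewrite -prime_coprime // coprime_sym coprimeXl.
have uq : coprime u q.
  rewrite coprime_sym prime_coprime //; apply: contra qNb => qu.
  by rewrite bE expnS dvdn_mul.
apply/mem_cyclotomic_coset.
by rewrite -(coset_prime_power_unit _ uq); apply/mem_cyclotomic_coset;
  exists 0%N; rewrite muln1 bE mulnC.
Qed.

Section Sums.

Variables (R : comNzRingType) (z : R).
Hypothesis zq : z ^+ (q ^ t) = 1.

Let multiples k : {set 'I_(q ^ t)} := [set b : 'I__ | (q ^ k %| b)%N].
Let T k : R := \sum_(b in multiples k) z ^+ (b : nat).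
Let S m : R := pow_sum z (q ^ t) l (q ^ m)%N%:Z.

(** Translation by a multiple of [q ^ k] permutes the multiples of [q ^ j], and there are
    [q ^ (t - k)] such translations. *)
Lemma multiples_sum_mul j k : (j <= k <= t)%N -> T j * T k = T j *+ (q ^ (t - k)).
Proof.
case/andP=> le_jk le_kt.
have -> : (q ^ (t - k))%N = #|multiples k|.
  apply/esym; apply: (card_image_ord (f := fun r => (q ^ k * r)%N)).
  - exact: prime_power_gt0.
  - move=> a; rewrite inE; apply: (iffP idP) => [/dvdnP[r ->]|[r aE]].
      by exists r; rewrite mulnC.
    have dk : (q ^ k %| q ^ t)%N by apply: dvdn_exp2l.
    by rewrite -[X in is_true X](dvdn_modr _ dk) aE dvdn_modr // dvdn_mulr.
  - by move=> u v; rewrite -{1 2}(subnKC le_kt) expnD eqn_modMl ?prime_power_gt0.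
  - exact: prime_power_gt0.
apply: sum_expr_shift => // a b; rewrite !inE => ja kb.
exists (Ordinal (ltn_pmod (a + b) (prime_power_gt0 t))); last by rewrite /= modn_mod.
rewrite inE /= dvdn_modr ?dvdn_exp2l ?(leq_trans le_jk) // dvdn_add //.
by apply: dvdn_trans kb; apply: dvdn_exp2l.
Qed.

Lemma multiples_sumS j : (j < t)%N -> T j = S j + T j.+1.
Proof.
move=> lt_jt; rewrite /T (bigID (fun b : 'I__ => (q ^ j.+1 %| b)%N)) /= addrC.
congr (_ + _); apply: eq_bigl => b; rewrite ?mem_coset_prime_power // !inE //.
apply: andb_idl; apply: dvdn_trans; exact: dvdn_exp2l.
Qed.

(** The boundary case: both index sets are [{0}]. *)
Lemma multiples_sum_last : T t = S t.
Proof.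
apply: eq_bigl => b; rewrite inE; apply/idP/mem_cyclotomic_coset => [/eqP b0|[r bE]].
  by exists 0%N; rewrite muln1 modnn.
by rewrite /dvdn bE -modnMml modnn mul0n mod0n.
Qed.

Lemma multiples_sumE j : (j <= t)%N -> T j = \sum_(j <= m < t.+1) S m.
Proof.
elim: {j}(t - j)%N {-2}j (erefl (t - j)%N) => [|k IH] j jE le_jt.
  have -> : j = t by lia.
  by rewrite big_nat1 multiples_sum_last.
have lt_jt : (j < t)%N by lia.
rewrite big_ltn ?ltnS // -IH //; [exact: multiples_sumS | lia].
Qed.

(** Squaring [T j - T j.+1] gives, with [e = q ^ (t - j - 1)], the value [(q - 2) e T j + e T j.+1],
    which is [(q - 2) e S j + (q - 1) e T j.+1]. *)
Lemma coset_sum_sqr j : (1 < q - 1)%N -> (j < t)%N ->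
  S j * S j = S j *+ ((q - 2) * q ^ (t - j - 1))
    + (\sum_(j.+1 <= m < t.+1) S m) *+ totient (q ^ (t - j)).
Proof.
move=> q_gt2 lt_jt; have Tj := multiples_sumS lt_jt.
have -> : S j = T j - T j.+1 by rewrite Tj addrK.
rewrite -multiples_sumE //.
have T00 := @multiples_sum_mul j j; have T01 := @multiples_sum_mul j j.+1.
have T11 := @multiples_sum_mul j.+1 j.+1.
rewrite totient_pfactor ?subn_gt0 // -!subn1.
(* This removes the truncated subtractions [q - 2] and [q - 1]. *)
have [k kE] : exists k, q = k.+2 by exists (q - 2)%N; lia.
rewrite mulrBl !mulrBr [T j.+1 * T j]mulrC T00 ?T01 ?T11 ?leqnn ?leqnSn ?(ltnW lt_jt) //.
have -> : (q ^ (t - j) = q * q ^ (t - j - 1))%N by rewrite -expnS; congr (_ ^ _)%N; lia.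
have -> : (t - j.+1)%N = (t - j - 1)%N by lia.
move: (q ^ _)%N (T j) (T j.+1) => e x y.
rewrite kE subn2 subn1 /= !mulSn !mulrnDr mulrnBl.
move: (x *+ e) (y *+ e) (x *+ _) (y *+ _) => x1 y1 x2 y2; ring.
Qed.

End Sums.

End PrimitivePrimePower.

(** * Factorization of coset sums by the Chinese remainder theorem *)

Lemma coset_sum_crt (R : comNzRingType) (x : R) (n m l dn dm : nat) :
  (0 < n)%N -> (0 < m)%N -> coprime n m -> coprime dn dm ->
  is_mult_order n l%:Z dn -> is_mult_order m l%:Z dm -> x ^+ (n * m) = 1 ->
  exists y z : R, [/\ y ^+ n = 1, z ^+ m = 1 &
    forall c : nat,
      pow_sum x (n * m) l c%:Z = pow_sum y n l c%:Z * pow_sum z m l c%:Z].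
Proof.
move=> n_gt0 m_gt0 nm cd on om xnm.
(* These are the idempotents modulo [n * m]: [a = u * a + v * a], whence [x ^ a] is a power of
   [x ^ u] times a power of [x ^ v]. *)
pose u := chinese n m 1 0; pose v := chinese n m 0 1.
have xE a b : (a == b %[mod n])%N -> (a == b %[mod m])%N -> x ^+ a = x ^+ b.
  move=> an bm; rewrite -(expr_mod a xnm) -(expr_mod b xnm).
  by congr (_ ^+ _); apply/eqP; rewrite chinese_remainder // an bm.
have un : (u = 1 %[mod n])%N by apply: chinese_modl.
have um : (u = 0 %[mod m])%N by apply: chinese_modr.
have vn : (v = 0 %[mod n])%N by apply: chinese_modl.
have vm : (v = 1 %[mod m])%N by apply: chinese_modr.
have yn : (x ^+ u) ^+ n = 1.
  rewrite -exprM -(expr0 x); apply: xE; first by rewrite modnMl mod0n.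
  by rewrite -modnMml um mod0n mul0n mod0n.
have zm : (x ^+ v) ^+ m = 1.
  rewrite -exprM -(expr0 x); apply: xE; last by rewrite modnMl mod0n.
  by rewrite -modnMml vn mod0n mul0n mod0n.
exists (x ^+ u), (x ^+ v); split=> // c.
pose h (a : 'I_(n * m)) : 'I_n * 'I_m :=
  (Ordinal (ltn_pmod a n_gt0), Ordinal (ltn_pmod a m_gt0)).
have hI : injective h.
  move=> a b [an bm]; apply: val_inj => /=.
  rewrite -[LHS](modn_small (ltn_ord a)) -[RHS](modn_small (ltn_ord b)).
  by apply/eqP; rewrite chinese_remainder // an bm !eqxx.
have hB : bijective h by apply: inj_card_bij => //; rewrite card_prod !card_ord.
rewrite /pow_sum big_distrlr pair_big /= (reindex h) /=; last exact: onW_bij.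
apply: eq_big => [a | a _]; last first.
  rewrite (expr_mod _ yn) (expr_mod _ zm) -!exprM -exprD; apply: xE; apply/eqP.
    rewrite -modnDm -[(u * a %% n)%N]modnMml -[(v * a %% n)%N]modnMml un vn.
    by rewrite !modnMml mul1n mul0n modnDm addn0.
  rewrite -modnDm -[(u * a %% m)%N]modnMml -[(v * a %% m)%N]modnMml um vm.
  by rewrite !modnMml mul1n mul0n modnDm add0n.
apply/mem_cyclotomic_coset/andP => [[r aE] | []].
  split; apply/mem_cyclotomic_coset; exists r; rewrite /= modn_mod; apply/eqP.
    by have := chinese_remainder nm a (c * l ^ r); rewrite aE eqxx => /esym/andP[].
  by have := chinese_remainder nm a (c * l ^ r); rewrite aE eqxx => /esym/andP[].
case/mem_cyclotomic_coset=> r1; rewrite /= modn_mod => a1.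
case/mem_cyclotomic_coset=> r2; rewrite /= modn_mod => a2.
(* As the orders [dn] and [dm] are coprime, one exponent realizes both [l ^ r1] modulo [n] and
   [l ^ r2] modulo [m]. *)
exists (chinese dn dm r1 r2); apply/eqP; rewrite chinese_remainder // a1 a2.
have /eqP E1 : (l ^ r1 == l ^ chinese dn dm r1 r2 %[mod n])%N.
  by rewrite (mult_order_expn_eq _ _ on) chinese_modl.
have /eqP E2 : (l ^ r2 == l ^ chinese dn dm r1 r2 %[mod m])%N.
  by rewrite (mult_order_expn_eq _ _ om) chinese_modr.
by rewrite -modnMmr E1 modnMmr eqxx -modnMmr E2 modnMmr eqxx.
Qed.

Lemma cyclic_ring_expr (l n : nat) : (0 < n)%N ->
  'qX ^+ n = 1 :> cyclic_ring l n.
Proof.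
move=> n_gt0; pose f : {poly 'F_l} := 'X^n - 1.
have f0 : in_qpoly f f = 0.
  apply: val_inj; rewrite /= [mk_monic _](cyclic_modulusE _ n_gt0).
  by rewrite Pdiv.RingMonic.rmodpp ?monicXnsubC.
apply/eqP; rewrite -subr_eq0 -(in_qpoly1 f) -rmorphXn -rmorphB; apply/eqP; exact: f0.
Qed.

(** * Quadratic characters modulo [p], with values in ['F_p] *)

Section QuadraticCharacter.

Variables (p h : nat).
Hypotheses (pp : prime p) (ph : p.-1 = h.*2).

Lemma expr_double_half a : coprime a p -> (a%:R : 'F_p) ^+ h.*2 = 1.
Proof.
move=> ap; apply/eqP; rewrite -ph -totient_prime // -natrX -(mulr1n 1) eqr_Fp_nat //.
by rewrite Euler_exp_totient.
Qed.

Lemma quad_residue_expr_half a : quad_residue p a -> (a%:R : 'F_p) ^+ h = 1.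
Proof.
case=> ap [x xa]; have xp : coprime x p.
  by rewrite -(@coprime_pexpl 2) // -coprime_modl xa coprime_modl.
move/eqP: xa; rewrite -eqr_Fp_nat // => /eqP <-.
by rewrite natrX -exprM mul2n expr_double_half.
Qed.

(* If a^h = 1 with h odd, then a = a^(h + 1) is a square. *)
Lemma quad_nonresidue_expr_half a : odd h ->
  quad_nonresidue p a -> (a%:R : 'F_p) ^+ h = -1.
Proof.
move=> h_odd [ap aN]; have aE := expr_double_half ap.
have : (a%:R : 'F_p) ^+ h ^+ 2 == 1 by rewrite -exprM muln2 expr_double_half.
rewrite sqrf_eq1 => /orP[/eqP ah1|/eqP //]; case: aN.
exists (a ^ (h.+1)./2)%N; apply/eqP; rewrite -eqr_Fp_nat // -expnM muln2.
by rewrite even_halfK /= ?h_odd // natrX exprS ah1 mulr1.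
Qed.

(** Were [g ^ h = 1] modulo [p], lifting would give [g] order at most [phi(p^s)/2] modulo
    [p ^ s]. *)
Lemma primitive_root_expr_half s g : (0 < s)%N ->
  is_primitive_root (p ^ s) g%:Z -> (g%:R : 'F_p) ^+ h = -1.
Proof.
move=> s_gt0 og; have gp : coprime g p.
  by apply: coprime_dvdr (mult_order_coprime og); apply: dvdn_expn_pos.
have : (g%:R : 'F_p) ^+ h ^+ 2 == 1.
  by rewrite -exprM muln2 expr_double_half.
rewrite sqrf_eq1 => /orP[|/eqP //]; rewrite -natrX -(mulr1n 1) eqr_Fp_nat // => /eqP gh1.
have [phi_gt0] := (is_mult_orderP _ _ _).1 og.
move/(_ (totient (p ^ s) %/ 2)%N); rewrite (expn_half_lift pp ph s_gt0 gh1) eqxx.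
move/esym/dvdn_leq; rewrite (totient_prime_power_half pp ph) //.
rewrite muln_gt0 (half_pred_gt0 pp ph) expn_gt0 prime_gt0 // => /(_ isT).
rewrite totient_pfactor // ph -muln2 mulnAC -{2}[(h * _)%N]muln1.
by rewrite leq_pmul2l // muln_gt0 (half_pred_gt0 pp ph) expn_gt0 prime_gt0.
Qed.

End QuadraticCharacter.

(** * Assembly of the two product formulas *)

(** Multiplies the component identities: [a] and [b] stand for the factors modulo [p ^ s], and [c]
    for the common factor modulo [q ^ t]. *)
Lemma mulr_muln_sqr (R : comNzRingType) (a b c : R) (I : Type) (r : seq I)
    (S : I -> R) (k u v : nat) :
  a * b = a *+ k -> c * c = c *+ u + (\sum_(m <- r) S m) *+ v ->
  a * c * (b * c) = (a * c) *+ (k * u) + (\sum_(m <- r) a * S m) *+ (k * v).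
Proof.
move=> ab cc; rewrite mulrACA ab cc mulrnAl mulrDr !mulrnAr mulr_sumr.
by rewrite mulrnDl -!mulrnA [(u * k)%N]mulnC [(v * k)%N]mulnC.
Qed.

Theorem theorem4p16 (s t p q l : nat) (g : int)
    (hs : (1 <= s)%N) (ht : (1 <= t)%N)
    (hp : prime p) (hq : prime q) (hl : prime l)
    (hpq : p != q) (hpl : p != l) (hql : q != l)
    (hp_odd : odd p) (hq_odd : odd q)
    (hp4 : p = 3 %[mod 4])
    (hlp : is_mult_order (p ^ s) l%:Z (totient (p ^ s) %/ 2))
    (hlq : is_mult_order (q ^ t) l%:Z (totient (q ^ t)))
    (hgcd : gcdn (totient (p ^ s)) (totient (q ^ t)) = 2%N)
    (hgp : is_primitive_root (p ^ s) g)
    (hgq : is_primitive_root (q ^ t) g)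
    (i i' j : nat)
    (hii' : (i < i')%N) (hi' : (i' <= s - 1)%N) (hj : (j <= t - 1)%N) :
  (quad_residue p q ->
     chi_star p q s t l g i j * chi p q s t l i' j
     = (totient (p ^ (s - i')) %/ 2 * (q - 2) * q ^ (t - j - 1))%N%:R
         *: chi_star p q s t l g i j
       + (totient (p ^ (s - i')) %/ 2 * totient (q ^ (t - j)))%N%:R
         *: (\sum_(j.+1 <= m < t.+1) chi_star p q s t l g i m))
  /\
  (quad_nonresidue p q ->
     chi_star p q s t l g i j * chi p q s t l i' j
     = (totient (p ^ (s - i')) %/ 2 * (q - 2) * q ^ (t - j - 1))%N%:R
         *: chi_star p q s t l g i j
       + (totient (p ^ (s - i')) %/ 2 * totient (q ^ (t - j)))%N%:R
         *: (\sum_(j.+1 <= m < t.+1 | ~~ (2 %| m - j)%N) chi p q s t l i m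
             + \sum_(j.+1 <= m < t.+1 | (2 %| m - j)%N)
                 chi_star p q s t l g i m)).
Proof.
pose h := p.-1./2; have ph : p.-1 = h.*2 by rewrite /h; lia.
have h_odd : odd h by rewrite /h; lia.
have lt_i's : (i' < s)%N by lia.
have lt_jt : (j < t)%N by lia.
have q_gt2 : (1 < q - 1)%N by have := prime_gt1 hq; lia.
have p_ps : (p %| p ^ s)%N by exact: dvdn_expn_pos.
have q_qt : (q %| q ^ t)%N by exact: dvdn_expn_pos.
have n_gt0 : (0 < p ^ s * q ^ t)%N by rewrite muln_gt0 !expn_gt0 !prime_gt0.
have pq : coprime p q by rewrite prime_coprime // dvdn_prime2.
pose n := (p ^ s * q ^ t)%N.
(* The integer [g] is replaced by a natural representative, congruent to it modulo both prime
   powers. *)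
have [g' gE] : exists g' : nat, (g = g'%:Z %[mod n%:Z])%Z.
  exists `|(g %% n%:Z)%Z|%N; rewrite gez0_abs ?modz_mod //.
  by rewrite modz_ge0 // -lt0n.
have gEp : (g = g'%:Z %[mod (p ^ s)%N%:Z])%Z.
  by apply: eqz_mod_dvdm gE; rewrite dvdzE /n !absz_nat dvdn_mulr ?dvdnn.
have gEq : (g = g'%:Z %[mod (q ^ t)%N%:Z])%Z.
  by apply: eqz_mod_dvdm gE; rewrite dvdzE /n !absz_nat dvdn_mull ?dvdnn.
move: (eq_mult_order_mod gEp hgp) (eq_mult_order_mod gEq hgq) => {}hgp {}hgq.
have gp : coprime g' p by apply: coprime_dvdr p_ps (mult_order_coprime hgp).
have gq : coprime g' q by apply: coprime_dvdr q_qt (mult_order_coprime hgq).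
have starE a b : chi_star p q s t l g a b
    = pow_sum 'qX n l (p ^ a * q ^ b * g')%N%:Z.
  rewrite /chi_star /coset_sum.
  rewrite (@eq_cyclotomic_coset_mod _ _ _ (p ^ a * q ^ b * g')%N%:Z) //.
  by rewrite PoszM -modzMmr gE modzMmr.
(* A common divisor divides the gcd 2, and it is odd because [h] and [p] are. *)
have cop_ord : coprime (totient (p ^ s) %/ 2) (totient (q ^ t)).
  have phiE : totient (p ^ s) = (2 * (totient (p ^ s) %/ 2))%N.
    by rewrite (totient_prime_power_half hp ph) // totient_pfactor // ph -mul2n mulnA.
  have: odd (totient (p ^ s) %/ 2).
    by rewrite (totient_prime_power_half hp ph) // oddM h_odd oddX hp_odd orbT.
  move: phiE hgcd; move: (totient (p ^ s)) => phi; move: (phi %/ 2)%N => a ->.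
  move=> ab2 a_odd; rewrite /coprime; set d := gcdn a _.
  have d2 : (d %| 2)%N by rewrite -ab2 dvdn_gcd dvdn_mull ?dvdn_gcdl // dvdn_gcdr.
  have d_odd : odd d by apply: dvdn_odd a_odd; apply: dvdn_gcdl.
  by move: d_odd (dvdn_leq (isT : 0 < 2)%N d2); case: (d) => [|[|[|]]].
have ps_gt0 : (0 < p ^ s)%N by rewrite expn_gt0 prime_gt0.
have qt_gt0 : (0 < q ^ t)%N by rewrite expn_gt0 prime_gt0.
have cpq : coprime (p ^ s) (q ^ t) by rewrite coprimeXl ?coprimeXr.
have [y [z [yp zq crt]]] :=
  coset_sum_crt ps_gt0 qt_gt0 cpq cop_ord hlp hlq (cyclic_ring_expr l n_gt0).
pose S m := pow_sum z (q ^ t) l (q ^ m)%N%:Z.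
pose A c := pow_sum y (p ^ s) l (p ^ i * c)%N%:Z.
(* Modulo [q ^ t] the factor [p ^ a * c] is a unit, so it does not affect the coset. *)
have prodE a b c : coprime c q ->
    pow_sum 'qX n l (p ^ a * q ^ b * c)%N%:Z
      = pow_sum y (p ^ s) l (p ^ a * (q ^ b * c))%N%:Z * S b.
  move=> cq.
  have qE : cyclotomic_coset (q ^ t) l (p ^ a * q ^ b * c)%N%:Z
      = cyclotomic_coset (q ^ t) l (q ^ b)%N%:Z.
    rewrite mulnAC mulnC (coset_prime_power_unit hq ht hlq) //.
    by rewrite coprimeMl cq coprimeXl.
  by rewrite crt /S /pow_sum qE mulnA.
have starS m : chi_star p q s t l g i m = A (q ^ m * g')%N * S m.
  by rewrite starE prodE.
have chiS a m : chi p q s t l a m = pow_sum y (p ^ s) l (p ^ a * q ^ m)%N%:Z * S m.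
  by rewrite -{1}[(q ^ m)%N]muln1 -prodE ?coprime1n // muln1.
have qp_cop m : coprime (q ^ m) p by rewrite coprimeXl // coprime_sym.
(* Common to both cases: each term of the last sum still carries the [y]-factor of [q ^ j * g']. *)
have main : chi_star p q s t l g i j * chi p q s t l i' j
     = (totient (p ^ (s - i')) %/ 2 * (q - 2) * q ^ (t - j - 1))%N%:R
         *: chi_star p q s t l g i j
       + (totient (p ^ (s - i')) %/ 2 * totient (q ^ (t - j)))%N%:R
         *: (\sum_(j.+1 <= m < t.+1) A (q ^ j * g')%N * S m).
  rewrite starS chiS !scaler_nat -mulnA; apply: mulr_muln_sqr.
    by apply: (coset_sum_shift hp ph hs hlp hgp yp) => //; rewrite ?coprimeMl ?qp_cop.
  exact: (coset_sum_sqr hq ht hlq zq).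
have A_eq a b : coprime b p -> (a%:R : 'F_p) ^+ h = b%:R ^+ h -> A a = A b.
  move=> bp /eqP; rewrite -!natrX eqr_Fp_nat // => /eqP abh.
  by rewrite /A /pow_sum (eq_coset_expn_half hp ph hs hlp hgp _ bp abh).
have g_half := primitive_root_expr_half hp ph hs hgp.
split=> [q_res | q_nres]; rewrite main; congr (_ + _ *: _).
  (* Here [q] has character 1, so [q ^ j * g'] and [q ^ m * g'] have the same character. *)
  apply: eq_bigr => m _; rewrite starS; congr (_ * _).
  apply: A_eq; first by rewrite coprimeMl qp_cop gp.
  rewrite !natrM !natrX !exprMn -!exprM ![(_ * h)%N]mulnC !exprM.
  by rewrite (quad_residue_expr_half hp ph q_res) !expr1n.
have q_half := quad_nonresidue_expr_half hp ph h_odd q_nres.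
(* Now [q] and [g'] both have character -1: that of [q ^ j * g'] agrees with that of [q ^ m] for odd
   [m - j], and with that of [q ^ m * g'] for even [m - j]. *)
rewrite (bigID (fun m => ~~ (2 %| m - j)%N)) /=; congr (_ + _).
  rewrite big_nat_cond [RHS]big_nat_cond; apply: eq_bigr => m /andP[/andP[lt_jm _] mj].
  rewrite chiS; congr (_ * _); rewrite -/(A _); apply: A_eq; first exact: qp_cop.
  rewrite !natrM !natrX !exprMn -!exprM ![(_ * h)%N]mulnC !exprM q_half g_half.
  rewrite -(subnKC (ltnW lt_jm)).
  by rewrite exprD -(signr_odd _ (m - j)); move: mj; rewrite dvdn2 negbK => ->.
rewrite big_nat_cond [RHS]big_nat_cond; apply: eq_big => m; rewrite ?negbK //.
move=> /andP[/andP[lt_jm _] mj]; rewrite starS; congr (_ * _).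
apply: A_eq; first by rewrite coprimeMl qp_cop gp.
rewrite !natrM !natrX !exprMn -!exprM ![(_ * h)%N]mulnC !exprM q_half.
rewrite -(subnKC (ltnW lt_jm)).
rewrite exprD -(signr_odd _ (m - j)).
by move: mj; rewrite dvdn2 => /negbTE->; rewrite mulr1.
Qed.
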